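(* For every integer $n\ge 0$, \begin{align*} F_{(4,0,0),n}(q)&=\sum_{n_1=0}^n\sum_{n_2=0}^{2n_1} \frac{q^{n_1^2+n_2^2-n_1n_2+n_1+n_2}}{(q;q)_{n-n_1}(q;q)_{n_1}}\begin{bmatrix}2n_1\\ n_2\end{bmatrix}_q,\\ F_{(3,1,0),n}(q)&=\sum_{n_1=0}^n\sum_{n_2=0}^{2n_1} \frac{q^{n_1^2+n_2^2-n_1n_2+n_2}}{(q;q)_{n-n_1}(q;q)_{n_1}}\begin{bmatrix}2n_1\\ n_2\end{bmatrix}_q,\\ F_{(3,0,1),n}(q)&=\sum_{n_1=0}^n\sum_{n_2=0}^{2n_1} \frac{q^{n_1^2+n_2^2-n_1n_2}}{(q;q)_{n-n_1}}\frac{q^{n_1}}{(q;q)_{n_1}}\begin{bmatrix}2n_1\\ n_2\end{bmatrix}_q +\sum_{n_1=1}^n\sum_{n_2=0}^{2n_1-2} \frac{q^{n_1^2+n_2^2-n_1n_2}}{(q;q)_{n-n_1}}\frac{q^{2n_2}}{(q;q)_{n_1-1}}\begin{bmatrix}2n_1-2\\ n_2\end{bmatrix}_q,\\ F_{(2,2,0),n}(q)&=\sum_{n_1=0}^n\sum_{n_2=0}^{2n_1} \frac{q^{n_1^2+n_2^2-n_1n_2}}{(q;q)_{n-n_1}}\frac{q^{n_1}}{(q;q)_{n_1}}\begin{bmatrix}2n_1\\ n_2\end{bmatrix}_q +\sum_{n_1=1}^n\sum_{n_2=0}^{2n_1-2} \frac{q^{n_1^2+n_2^2-n_1n_2}}{(q;q)_{n-n_1}}\frac{q^{n_2}(1+q^{n_1+n_2})}{(q;q)_{n_1-1}}\begin{bmatrix}2n_1-2\\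 n_2\end{bmatrix}_q,\\ F_{(2,1,1),n}(q)&=\sum_{n_1=0}^n\sum_{n_2=0}^{2n_1} \frac{q^{n_1^2+n_2^2-n_1n_2}}{(q;q)_{n-n_1}(q;q)_{n_1}}\begin{bmatrix}2n_1\\ n_2\end{bmatrix}_q. \end{align*}
   Context: Partitions are weakly decreasing sequences $\lambda=(\lambda_1,\lambda_2,\ldots)$ of nonnegative integers with finitely many nonzero terms (so $\lambda_j=0$ for $j$ large). Given a composition $c=(c_1,\ldots,c_k)$ of a positive integer into $k$ nonnegative parts, a cylindric partition of profile $c$ is a sequence $\Lambda=(\lambda^{(1)},\ldots,\lambda^{(k)})$ of $k$ partitions such that $\lambda^{(i)}_j\ge\lambda^{(i+1)}_{j+c_{i+1}}$ for all $1\le i\le k-1$ and all $j\ge1$, and $\lambda^{(k)}_j\ge\lambda^{(1)}_{j+c_1}$ for all $j\ge1$. Set $|\Lambda|=\sum_{i=1}^k\sum_{j\ge1}\lambda^{(i)}_j$ and $\max(\Lambda)=\max(\lambda^{(1)}_1,\ldots,\lambda^{(k)}_1)$. For an integer $n\ge0$, $F_{c,n}(q)=\sum q^{|\Lambda|}$, the sum over all cylindric partitions $\Lambda$ of profile $c$ with $\max(\Lambda)\le n$. Notation: $(a;q)_n=\prod_{i=0}^{n-1}(1-aq^i)$, and $\begin{bmatrix}n\\ k\end{bmatrix}_q=\frac{(q;q)_n}{(q;q)_k(q;q)_{n-k}}$ for $0\le k\le n$. *)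

(* Defs.v *)
From HB Require Import structures.
From mathcomp Require Import all_boot all_order all_algebra.
From mathcomp Require Import finmap.
From mathcomp Require Import boolp classical_sets cardinality fsbigop.

Set Implicit Arguments.
Unset Strict Implicit.
Unset Printing Implicit Defensive.

Import GRing.Theory.
Local Open Scope ring_scope.

Record fps (R : Type) := Fps { fps_coef :> nat -> R }.

HB.instance Definition _ (R : Type) := gen_eqMixin (fps R).
HB.instance Definition _ (R : Type) := gen_choiceMixin (fps R).

Lemma fpsP (R : Type) (f g : fps R) : (forall m, f m = g m) <-> f = g.
Proof.
split=> [|-> //]; case: f g => f [g] /= fg; congr Fps; exact/funext.
Qed.

Section FpsRing.
Variable R : comNzRingType.
Implicit Types f g h : fps R.

Definition fps_zero := Fps (fun=> 0 : R).
Definition fps_opp f := Fps (fun m => - f m).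
Definition fps_add f g := Fps (fun m => f m + g m).
Definition fps_one := Fps (fun m => (m == 0%N)%:R : R).
Definition fps_mul f g := Fps (fun m => \sum_(i < m.+1) f i * g (m - i)%N).

Lemma fps_addA : associative fps_add.
Proof. by move=> f g h; apply/fpsP => m /=; rewrite addrA. Qed.
Lemma fps_addC : commutative fps_add.
Proof. by move=> f g; apply/fpsP => m /=; rewrite addrC. Qed.
Lemma fps_add0 : left_id fps_zero fps_add.
Proof. by move=> f; apply/fpsP => m /=; rewrite add0r. Qed.
Lemma fps_addN : left_inverse fps_zero fps_opp fps_add.
Proof. by move=> f; apply/fpsP => m /=; rewrite addNr. Qed.

HB.instance Definition _ :=
  GRing.isZmodule.Build (fps R) fps_addA fps_addC fps_add0 fps_addN.

Definition fps_trunc N f : {poly R} := \poly_(i < N) f i.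

Lemma fps_mul_trunc N f g m : (m < N)%N ->
  fps_mul f g m = (fps_trunc N f * fps_trunc N g)`_m.
Proof.
move=> mN; rewrite coefM; apply: eq_bigr => i _; rewrite !coef_poly.
by rewrite (leq_ltn_trans (leq_ord i) mN) (leq_ltn_trans (leq_subr _ _) mN).
Qed.

Lemma coef_mul_congr (p p' r r' : {poly R}) m :
  (forall i, (i <= m)%N -> p`_i = p'`_i) ->
  (forall i, (i <= m)%N -> r`_i = r'`_i) -> (p * r)`_m = (p' * r')`_m.
Proof.
move=> pp rr; rewrite !coefM; apply: eq_bigr => i _.
by rewrite pp ?rr ?leq_subr ?leq_ord.
Qed.

Lemma coef_trunc_mul N f g m : (m < N)%N ->
  (fps_trunc N (fps_mul f g))`_m = (fps_trunc N f * fps_trunc N g)`_m.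
Proof. by move=> mN; rewrite coef_poly mN; apply: fps_mul_trunc. Qed.

Lemma fps_mulA : associative fps_mul.
Proof.
move=> f g h; apply/fpsP => m; have mm := ltnSn m.
rewrite !(fps_mul_trunc _ _ mm).
transitivity
  ((fps_trunc m.+1 f * (fps_trunc m.+1 g * fps_trunc m.+1 h))`_m).
  by apply: coef_mul_congr => // i im; apply: coef_trunc_mul.
rewrite mulrA; apply: coef_mul_congr => // i im.
by rewrite coef_trunc_mul.
Qed.

Lemma fps_mulC : commutative fps_mul.
Proof.
move=> f g; apply/fpsP => m.
by rewrite !(fps_mul_trunc _ _ (ltnSn m)) mulrC.
Qed.

Lemma fps_mul1 : left_id fps_one fps_mul.
Proof.
move=> f; apply/fpsP => m /=; rewrite big_ord_recl /= mul1r subn0.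
by rewrite big1 ?addr0 // => i _; rewrite mul0r.
Qed.

Lemma fps_mulDl : left_distributive fps_mul fps_add.
Proof.
move=> f g h; apply/fpsP => m /=; rewrite -big_split /=.
by apply: eq_bigr => i _; rewrite mulrDl.
Qed.

Lemma fps_one_neq0 : fps_one != 0.
Proof.
by apply/eqP => /fpsP /(_ 0%N) /= /eqP; rewrite oner_eq0.
Qed.

HB.instance Definition _ := GRing.Zmodule_isComNzRing.Build (fps R)
  fps_mulA fps_mulC fps_mul1 fps_mulDl fps_one_neq0.

Definition fpsX : fps R := Fps (fun m => (m == 1%N)%:R).

Lemma coef_fps0 m : (0 : fps R) m = 0. Proof. by []. Qed.
Lemma coef_fps1 m : (1 : fps R) m = (m == 0%N)%:R. Proof. by []. Qed.
Lemma coef_fpsX m : fpsX m = (m == 1%N)%:R. Proof. by []. Qed.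
Lemma coef_fpsN f m : (- f) m = - f m. Proof. by []. Qed.
Lemma coef_fpsD f g m : (f + g) m = f m + g m. Proof. by []. Qed.
Lemma coef_fpsM f g m : (f * g) m = \sum_(i < m.+1) f i * g (m - i)%N.
Proof. by []. Qed.

End FpsRing.

Section FpsUnitRing.
Variable R : comUnitRingType.
Implicit Types f g : fps R.

(* The first N coefficients of the solution g of f * g = 1. *)
Fixpoint fps_inv_coefs f (N : nat) : seq R :=
  if N is m.+1 then
    let s := fps_inv_coefs f m in
    rcons s ((f 0%N)^-1 * ((m == 0%N)%:R - \sum_(i < m) s`_i * f (m - i)%N))
  else [::].

Definition fps_unit : pred (fps R) := fun f => f 0%N \is a GRing.unit.
Definition fps_inv f : fps R :=
  if fps_unit f then Fps (fun m => (fps_inv_coefs f m.+1)`_m) else f.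

Lemma size_fps_inv_coefs f N : size (fps_inv_coefs f N) = N.
Proof. by elim: N => //= N IH; rewrite size_rcons IH. Qed.

Lemma nth_fps_inv_coefs f N m : (m < N)%N ->
  (fps_inv_coefs f N)`_m = (fps_inv_coefs f m.+1)`_m.
Proof.
elim: N => // N IH; rewrite ltnS leq_eqVlt => /predU1P[-> //|mN].
by rewrite {1}/fps_inv_coefs -/fps_inv_coefs nth_rcons size_fps_inv_coefs mN IH.
Qed.

Lemma fps_mulVr : {in fps_unit, left_inverse 1 fps_inv *%R}.
Proof.
move=> f uf; have {}uf : fps_unit f by [].
rewrite /fps_inv uf; apply/fpsP => m.
rewrite coef_fpsM coef_fps1 big_ord_recr /= subnn.
rewrite nth_rcons size_fps_inv_coefs ltnn eqxx.
rewrite mulrAC mulVr // mul1r.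
rewrite (_ : \sum_(i < m) _ =
  \sum_(i < m) (fps_inv_coefs f m)`_i * f (m - i)%N); first by rewrite subrKC.
by apply: eq_bigr => i _; rewrite -(nth_fps_inv_coefs f (ltn_ord i)).
Qed.

Lemma fps_unitP f g : g * f = 1 -> fps_unit f.
Proof.
move=> /fpsP /(_ 0%N); rewrite coef_fpsM big_ord1 coef_fps1 /= => gf.
by apply/unitrPr; exists (g 0%N); rewrite mulrC.
Qed.

Lemma fps_invr_out : {in [predC fps_unit], fps_inv =1 id}.
Proof. by move=> f nuf; rewrite /fps_inv (negPf (nuf : ~~ fps_unit f)). Qed.

HB.instance Definition _ := GRing.ComNzRing_hasMulInverse.Build (fps R)
  fps_mulVr fps_unitP fps_invr_out.

Lemma fps_unitE f : (f \is a GRing.unit) = (f 0%N \is a GRing.unit).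
Proof. by []. Qed.

End FpsUnitRing.

Definition qpoch (R : comUnitRingType) (a q : R) (n : nat) : R :=
  \prod_(i < n) (1 - a * q ^+ i).

Definition qbinom (R : comUnitRingType) (q : R) (n k : nat) : R :=
  qpoch q q n / (qpoch q q k * qpoch q q (n - k)).

(* Indices start at 0: [lam j] is the part of index j + 1,
   [L i] is the partition of index i + 1, and [tnth c i] is the entry of index
   i + 1 of the profile. *)

Local Open Scope classical_set_scope.

Definition is_partition (lam : nat -> nat) : Prop :=
  (forall i j, i <= j -> lam j <= lam i)%N /\
  finite_set [set j | lam j <> 0%N].

(* [ordS] is the cyclic successor, so this covers both the k - 1 inequalities
   between consecutive partitions and the one that closes the cylinder. *)
Definition is_cylindric (k : nat) (c : k.-tuple nat) (L : 'I_k -> nat -> nat)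
    : Prop :=
  (forall i, is_partition (L i)) /\
  (forall i j, L (ordS i) (j + tnth c (ordS i)) <= L i j)%N.

Definition cyl_size (k : nat) (L : 'I_k -> nat -> nat) : nat :=
  (\sum_(i < k) \big[addn/0]_(j \in [set: nat]) L i j)%N.

Definition cyl_max (k : nat) (L : 'I_k -> nat -> nat) : nat :=
  (\max_(i < k) L i 0)%N.

Definition cyl_set (k : nat) (c : k.-tuple nat) (n m : nat)
    : set ('I_k -> nat -> nat) :=
  [set L | [/\ is_cylindric c L, (cyl_max L <= n)%N & cyl_size L = m]].

(* [fset_set] is meaningful only on finite sets: see [finite_cyl_set]. *)
Definition cylF (k : nat) (c : k.-tuple nat) (n : nat) : fps int :=
  Fps (fun m => (#|` fset_set (cyl_set c n m)|)%:R).

Lemma leq_size_partition (lam : nat -> nat) (N : nat) : is_partition lam ->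
  (\sum_(j < N) lam j <= \big[addn/0]_(j \in [set: nat]) lam j)%N.
Proof.
move=> [_ fin].
have fin' : finite_set ([set j | lam j <> 0%N] `|` `I_N).
  by rewrite finite_setU; split=> //; apply: finite_II.
rewrite fsbig_ord -(fsbig_widen ([set j | lam j <> 0%N] `|` `I_N) setT) //;
  last by move=> j [_ /= /not_orP[/contrapT]].
rewrite (fsbigID `I_N ([set j | lam j <> 0%N] `|` `I_N)) //=.
rewrite (_ : _ `&` `I_N = `I_N); first exact: leq_addr.
by apply/seteqP; split=> j /=; [case|split=> //; right].
Qed.

Lemma finite_cyl_set (k : nat) (c : k.-tuple nat) (n m : nat) :
  finite_set (cyl_set c n m).
Proof.
pose ext (u : {ffun 'I_k * 'I_m -> 'I_n.+1}) : 'I_k -> nat -> nat :=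
  fun i j => if insub j is Some j' then nat_of_ord (u (i, j')) else 0%N.
apply: (@sub_finite_set _ _ (range ext)); last first.
  by apply: finite_image; apply: finite_finset.
move=> L [[part _] maxL sizeL].
exists [ffun p : 'I_k * 'I_m => inord (L p.1 p.2)] => //.
apply/funext => i; apply/funext => j; rewrite /ext.
have [dec _] := part i.
case: insubP => [j' _ <-|]; rewrite ?ffunE /= ?inordK //.
  rewrite ltnS (leq_trans (dec _ _ (leq0n _))) //.
  by apply: leq_trans maxL; apply: (leq_bigmax i).
rewrite -leqNgt => mj; apply/esym/eqP; rewrite -leqn0 leqNgt; apply/negP => Lij.
have : (m.+1 <= cyl_size L)%N.
  rewrite /cyl_size (bigD1 i) //=; apply: leq_trans (leq_addr _ _).
  apply: leq_trans (leq_size_partition m.+1 (part i)).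
  rewrite -[leqLHS]card_ord -sum1_card; apply: leq_sum => /= l _.
  by apply: leq_trans Lij (dec _ _ _); apply: leq_trans mj; rewrite -ltnS.
by rewrite sizeL ltnn.
Qed.

(* Main.v *)
(** For a profile [c] let [I] be the set of indices [i] with [c_i > 0]. The
    maximum of a cylindric partition is attained at the first part of some row
    of [I], and removing a first part equal to [n] from all rows of a set [J]
    turns profile [c] into another profile [c(J)]. Inclusion-exclusion gives
      [F_(c,n) - F_(c,n-1)
         = \sum_(J in I, J nonempty) (-1)^(|J|-1) q^(n|J|) F_(c(J),n)].
    Up to rotation there are five profiles of length 3 and sum 4, and the
    resulting linear system, with [F_(c,0) = 1], has only one solution.

    The right-hand sides are [\sum_m P_c(m) / (q)_(n-m)], and this transform
    turns the system into recurrences for the [P_c]. All of them reduce to two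
    first-order relations between [P_211] and [P_310], which follow from a
    three-term recurrence for the moments
    [\sum_k q^(m^2 + k^2 - m k + j k) [2m, k]]. *)
Require Import Defs.
From mathcomp Require Import all_boot all_order all_algebra.
From mathcomp Require Import finmap boolp classical_sets cardinality fsbigop.
From mathcomp Require Import ring zify.

Set Implicit Arguments.
Unset Strict Implicit.
Unset Printing Implicit Defensive.

Import GRing.Theory.
Local Open Scope ring_scope.

(** * Gaussian binomials *)

Section LinearCombination.
Variable R : comNzRingType.
Implicit Types a b c l r : R.

(** Certificate form of linear elimination: the coefficients are supplied by hand and the remaining
    polynomial identity is left to [ring]. *)
Lemma eq_comb2 c1 c2 l1 r1 l2 r2 a b : l1 = r1 -> l2 = r2 ->
  a - b = c1 * (l1 - r1) + c2 * (l2 - r2) -> a = b.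
Proof.
by move=> -> ->; rewrite !subrr !mulr0 addr0 => /eqP; rewrite subr_eq0 => /eqP.
Qed.

Lemma eq_comb3 c1 c2 c3 l1 r1 l2 r2 l3 r3 a b : l1 = r1 -> l2 = r2 -> l3 = r3 ->
  a - b = c1 * (l1 - r1) + c2 * (l2 - r2) + c3 * (l3 - r3) -> a = b.
Proof.
move=> -> -> ->; rewrite !subrr !mulr0 !addr0 => /eqP.
by rewrite subr_eq0 => /eqP.
Qed.

End LinearCombination.
Arguments eq_comb2 [R] c1 c2 [l1 r1 l2 r2 a b].
Arguments eq_comb3 [R] c1 c2 c3 [l1 r1 l2 r2 l3 r3 a b].

Section GaussBinomial.
Variables (R : comNzRingType) (q : R).

(* Unlike [qbinom], this vanishes for [n < k]. *)
Fixpoint gbinom n k : R :=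
  match n, k with
  | _, 0%N => 1
  | 0%N, _.+1 => 0
  | n'.+1, k'.+1 => gbinom n' k' + q ^+ k * gbinom n' k
  end.

Lemma gbinom0 n : gbinom n 0 = 1.
Proof. by case: n. Qed.

Lemma gbinomS n k :
  gbinom n.+1 k.+1 = gbinom n k + q ^+ k.+1 * gbinom n k.+1.
Proof. by []. Qed.

Lemma gbinom_small n k : (n < k)%N -> gbinom n k = 0.
Proof.
elim: n k => [|n IHn] [|k] //; rewrite ltnS => nk.
by rewrite gbinomS !IHn ?mulr0 ?addr0 // ltnW.
Qed.

(** Ratio of neighbours in a row, proved by induction on [n] through Pascal's rule. In the main case
    both sides reduce to (1 - q^(n+1)) [n, k+1]. *)
Lemma gbinom_step n k : (k <= n)%N ->
  (1 - q ^+ k.+1) * gbinom n k.+1 = (1 - q ^+ (n - k)) * gbinom n k.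
Proof.
elim: n k => [|n IHn] [|k] // kn.
- by rewrite gbinom0 /= subrr !(mulr0, mul0r).
- rewrite gbinomS !gbinom0 subn0 mulrDr mulrCA IHn // gbinom0 subn0.
  by rewrite [q ^+ n.+1]exprS; ring.
- have {kn} kn : (k <= n)%N by [].
  have -> : (n.+1 - k.+1 = n - k)%N by [].
  have eqn : q ^+ k.+1 * q ^+ (n - k) = q ^+ n.+1.
    by rewrite -exprD addSn subnKC.
  have lhs : (1 - q ^+ (n - k)) * gbinom n.+1 k.+1
             = (1 - q ^+ n.+1) * gbinom n k.+1.
    by rewrite gbinomS mulrDr -IHn // -eqn; ring.
  rewrite lhs gbinomS mulrDr mulrCA.
  (* For k = n the induction hypothesis at k + 1 is out of range, but then both sides vanish. *)
  case: (ltngtP k n) kn => // [kn|->] _.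
    have eqn' : q ^+ k.+2 * q ^+ (n - k.+1) = q ^+ n.+1.
      by rewrite -exprD addSn subnKC.
    by rewrite IHn // -eqn'; ring.
  by rewrite !gbinom_small ?ltnS //; ring.
Qed.

Lemma gbinom_diag n k :
  (1 - q ^+ k.+1) * gbinom n.+1 k.+1 = (1 - q ^+ n.+1) * gbinom n k.
Proof.
have [kn|nk] := leqP k n; last by rewrite !gbinom_small ?mulr0.
have <- : q ^+ k.+1 * q ^+ (n - k) = q ^+ n.+1 by rewrite -exprD addSn subnKC.
by rewrite gbinomS mulrDr mulrCA gbinom_step //; ring.
Qed.

(** Pascal's rule moved onto the weight: lowering the top index replaces f(k) by f(k+1) + q^k
    f(k). *)
Lemma sum_gbinomS n (f : nat -> R) :
  \sum_(0 <= k < n.+2) f k * gbinom n.+1 k =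
  \sum_(0 <= k < n.+1) (f k.+1 + q ^+ k * f k) * gbinom n k.
Proof.
rewrite big_nat_recl // gbinom0.
under eq_bigr do rewrite gbinomS mulrDr.
rewrite big_split /= addrCA.
under [RHS]eq_bigr do rewrite mulrDl.
rewrite [RHS]big_split /=; congr (_ + _).
rewrite [RHS]big_nat_recl // gbinom0 [X in _ + X = _]big_nat_recr //=.
rewrite gbinom_small // !mulr0 addr0 expr0 mul1r mulr1; congr (_ + _).
by apply: eq_bigr => k _; ring.
Qed.

Lemma sum_gbinomSS n (f : nat -> R) :
  \sum_(0 <= k < n.+3) f k * gbinom n.+2 k =
  \sum_(0 <= k < n.+1)
    (f k.+2 + q ^+ k * (1 + q) * f k.+1 + q ^+ (2 * k) * f k) * gbinom n k.
Proof.
rewrite !sum_gbinomS; apply: eq_bigr => k _; congr (_ * _).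
by rewrite mulnC exprM exprS; ring.
Qed.

(** * The quadratic exponent and the moments it defines *)

Definition quadf m k : nat := (m ^ 2 + k ^ 2 - m * k)%N.

(** The subtraction in [quadf] never truncates, because m k <= m^2 + k^2. Where a shift could lower
    the value, the negative term is moved to the left. *)
Lemma quadfS m k : (quadf m k.+1 + m = quadf m k + 2 * k + 1)%N.
Proof. by rewrite /quadf; nia. Qed.

Lemma quadfS0 m k : (quadf m.+1 k + k = quadf m k + 2 * m + 1)%N.
Proof. by rewrite /quadf; nia. Qed.

Lemma quadfS1 m k : (quadf m.+1 k.+1 = quadf m k + m + k + 1)%N.
Proof. by rewrite /quadf; nia. Qed.

Lemma quadfS2 m k : (quadf m.+1 k.+2 = quadf m k + 3 * k + 3)%N.
Proof. by rewrite /quadf; nia. Qed.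

Definition moment m j : R :=
  \sum_(0 <= k < (2 * m).+1) q ^+ (quadf m k + j * k) * gbinom (2 * m) k.

(** The difference of two consecutive moments weights each term by 1 - q^k. [gbinom_step] lowers the
    index of this weighted binomial, and reindexing k as k + 1 then shifts [quadf]; the factor q^m
    is the one required by [quadfS]. *)
Lemma moment_rec m j : q ^+ m * (moment m j - moment m j.+1) =
  q ^+ j.+1 * (moment m j.+2 - q ^+ (2 * m) * moment m j.+1).
Proof.
have -> : q ^+ m * (moment m j - moment m j.+1) =
    \sum_(0 <= k < (2 * m).+2)
      q ^+ (quadf m k + m + j * k) * ((1 - q ^+ k) * gbinom (2 * m) k).
  (* The range is extended by k = 2m + 1, where the binomial is 0, to make room for the index
     shift. *)
  rewrite big_nat_recr //= gbinom_small // !mulr0 addr0 /moment.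
  rewrite -sumrB mulr_sumr.
  by apply: eq_bigr => k _; rewrite mulSn !exprD; ring.
(* The term k = 0 disappears because of its factor 1 - q^0. *)
rewrite big_nat_recl // expr0 subrr mul0r mulr0 add0r /moment mulr_sumr -sumrB.
rewrite mulr_sumr; apply: eq_big_nat => k /andP[_]; rewrite ltnS => km.
rewrite gbinom_step // quadfS.
have e1 : q ^+ (2 * m) = q ^+ k * q ^+ (2 * m - k) by rewrite -exprD subnKC.
rewrite e1 !mulSn !mul0n mulnS !addn0 !exprD expr1 exprS.
by ring.
Qed.

(** Two Pascal steps lead from [2m+2, k] to [2m, k]; [quadfS2], [quadfS1] and [quadfS0] rewrite the
    three resulting weights. *)
Lemma moment_S m j : moment m.+1 j =
  q ^+ (2 * j + 3) * moment m (j + 3)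
  + q ^+ (m + j + 1) * (1 + q) * moment m (j + 2)
  + q ^+ (2 * m + 1) * moment m (j + 1).
Proof.
rewrite /moment (_ : 2 * m.+1 = (2 * m).+2)%N; last by lia.
rewrite sum_gbinomSS !mulr_sumr -!big_split /=; apply: eq_bigr => k _.
rewrite quadfS2 quadfS1 -[q ^+ (2 * k) * _]mulrC.
have -> : q ^+ (quadf m.+1 k + j * k) * q ^+ (2 * k) =
          q ^+ (2 * m + 1) * q ^+ (quadf m k + (j + 1) * k).
  by rewrite -!exprD; congr (q ^+ _); have := quadfS0 m k; nia.
rewrite !mulrA -!mulrDl; congr (_ * _); congr (_ + _ + _).
  by rewrite -exprD; congr (q ^+ _); nia.
rewrite mulrAC -exprD mulrAC -exprD; congr (q ^+ _ * _); nia.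
Qed.

Lemma moment0_S m : let y := q ^+ m in moment m.+1 0 =
  q * y ^+ 2 * (1 + q * y) * moment m 0
  + q * y * (1 + q ^+ 2 * y ^+ 3) * moment m 1.
Proof.
have := moment_S m 0; have := moment_rec m 1; have := moment_rec m 0.
rewrite (mulnC 2%N m) exprM ![q ^+ (_ + 1)]exprD exprM addn0.
move: (q ^+ m) (moment m 0) (moment m 1) (moment m 2) (moment m 3).
move=> y w0 w1 w2 w3 r0 r1 ->.
(* The multiple of [r1] eliminates the moment of order 3, and that of [r0] then eliminates order
   2. *)
by apply: (eq_comb2 (- (q * y * (1 + q * y))) (- q) r0 r1); ring.
Qed.

(** The moment of order 0 at m + 1 is kept on the right so that the other terms carry 1 - q^(2m+2).
    This is divisible by 1 - q^(m+1), which makes [P310_S] free of denominators. *)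
Lemma moment1_S m : let y := q ^+ m in moment m.+1 1 =
  (q * y) ^+ 2 * moment m.+1 0
  + q * y ^+ 2 * (1 - (q * y) ^+ 2) * (moment m 0 + q * y * moment m 1).
Proof.
have := moment_S m 0; have := moment_S m 1.
have := moment_rec m 2; have := moment_rec m 1; have := moment_rec m 0.
rewrite (mulnC 2%N m) exprM ![q ^+ (_ + 1)]exprD exprM addn0 exprD /=.
move: (q ^+ m) (moment m 0) (moment m 1) (moment m 2) (moment m 3) (moment m 4).
move=> y w0 w1 w2 w3 w4 r0 r1 r2 -> ->.
apply: (eq_comb3 (- (q * y * (1 - (q * y) ^+ 2))) (- (q * y)) (- q ^+ 2)
          r0 r1 r2).
by ring.
Qed.

End GaussBinomial.

(** * The transform of the right-hand sides *)

(* The recurrences of [cylF] for the five rotation classes of profiles of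
   length 3 and sum 4. *)
Record cyl_system (R : pzRingType) (q : R) (f400 f310 f301 f220 f211 : nat -> R)
    : Prop := {
  cyl_system_init :
    [/\ f400 0%N = 1, f310 0%N = 1, f301 0%N = 1, f220 0%N = 1 & f211 0%N = 1];
  cyl_system_400 n :
    f400 n.+1 = f400 n + q ^+ n.+1 * f310 n.+1;
  cyl_system_310 n :
    f310 n.+1 = f310 n + q ^+ n.+1 * (f220 n.+1 + f301 n.+1)
                - q ^+ (2 * n.+1) * f211 n.+1;
  cyl_system_301 n :
    f301 n.+1 = f301 n + q ^+ n.+1 * (f211 n.+1 + f400 n.+1)
                - q ^+ (2 * n.+1) * f310 n.+1;
  cyl_system_220 n :
    f220 n.+1 = f220 n + q ^+ n.+1 * (f301 n.+1 + f211 n.+1)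
                - q ^+ (2 * n.+1) * f211 n.+1;
  cyl_system_211 n :
    f211 n.+1 = f211 n + q ^+ n.+1 * (f211 n.+1 + f220 n.+1 + f310 n.+1)
                - q ^+ (2 * n.+1) * (f211 n.+1 + f220 n.+1 + f301 n.+1)
                + q ^+ (3 * n.+1) * f211 n.+1 }.

Section QTransform.
Variables (R : comUnitRingType) (q : R).
Hypothesis qpoch_unit : forall n, qpoch q q n \is a GRing.unit.
Implicit Types f g : nat -> R.

Lemma qpoch0 : qpoch q q 0 = 1.
Proof. by rewrite /qpoch big_ord0. Qed.

Lemma qpochS n : qpoch q q n.+1 = qpoch q q n * (1 - q ^+ n.+1).
Proof. by rewrite /qpoch big_ord_recr /= -exprS. Qed.

Lemma qpoch_invS n : (1 - q ^+ n.+1) / qpoch q q n.+1 = (qpoch q q n)^-1.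
Proof.
have := qpoch_unit n.+1; rewrite qpochS unitrM => /andP[u1 u2].
by rewrite invrM // mulrA divrr // mul1r.
Qed.

(** Induction along a diagonal, where n - k is constant and [gbinom_diag] supplies the ratio. *)
Lemma gbinom_qpoch n k : (k <= n)%N ->
  gbinom q n k * (qpoch q q k * qpoch q q (n - k)) = qpoch q q n.
Proof.
elim: n k => [|n IHn] [|k] //; first by rewrite !qpoch0 !mulr1.
  by rewrite gbinom0 qpoch0 !mul1r.
rewrite ltnS subSS => kn; rewrite !qpochS -(IHn k kn).
have := gbinom_diag q n k; move: (gbinom q n.+1 k.+1) => g gE.
have -> : forall a b, g * (a * (1 - q ^+ k.+1) * b) =
                      (1 - q ^+ k.+1) * g * (a * b) by move=> a b; ring.
by rewrite gE; ring.
Qed.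

Lemma qbinomE n k : (k <= n)%N -> qbinom q n k = gbinom q n k.
Proof.
by move=> kn; rewrite /qbinom -(gbinom_qpoch kn) mulrK // unitrM !qpoch_unit.
Qed.

(** On generating functions A(z) = sum_n f(n) z^n, these three operators are multiplication by z,
    multiplication by 1 - z, and the substitution of q z for z. *)
Definition seq_shift f n : R := if n is m.+1 then f m else 0.
Definition seq_diff f n : R := f n - seq_shift f n.
Definition seq_scale f n : R := q ^+ n * f n.

(** On generating functions this is multiplication by sum_n z^n / (q;q)_n = 1 / (z;q)_infinity.
    Hence it commutes with [seq_shift] and [seq_diff], while [seq_scale] costs a factor 1 - z. *)
Definition qtrans f n : R :=
  \sum_(0 <= m < n.+1) f m / qpoch q q (n - m).

Lemma eq_qtrans f g : f =1 g -> qtrans f =1 qtrans g.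
Proof. by move=> fg n; apply: eq_bigr => m _; rewrite fg. Qed.

Lemma qtransD f g n : qtrans (fun m => f m + g m) n = qtrans f n + qtrans g n.
Proof.
by rewrite /qtrans -big_split /=; apply: eq_bigr => m _; rewrite mulrDl.
Qed.

Lemma qtransB f g n : qtrans (fun m => f m - g m) n = qtrans f n - qtrans g n.
Proof. by rewrite /qtrans -sumrB; apply: eq_bigr => m _; rewrite mulrBl. Qed.

Lemma qtrans0 f : qtrans f 0 = f 0%N.
Proof. by rewrite /qtrans big_nat1 qpoch0 divr1. Qed.

Lemma qtrans_shift f n : qtrans (seq_shift f) n = seq_shift (qtrans f) n.
Proof.
case: n => [|n]; first by rewrite qtrans0.
by rewrite /qtrans big_nat_recl //= mul0r add0r.
Qed.

Lemma qtrans_diff f n : qtrans (seq_diff f) n = seq_diff (qtrans f) n.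
Proof. by rewrite qtransB qtrans_shift. Qed.

(* [q^(n-m) / (q)_(n-m) = 1 / (q)_(n-m) - 1 / (q)_(n-m-1)] *)
Lemma qtrans_scale f n :
  q ^+ n * qtrans f n = seq_diff (qtrans (seq_scale f)) n.
Proof.
case: n => [|n]; first by rewrite /seq_diff /= subr0 !qtrans0.
rewrite /seq_diff /seq_shift /qtrans /seq_scale mulr_sumr.
rewrite !(big_nat_recr n.+1) //=.
rewrite subnn qpoch0 !divr1 addrAC -sumrB; congr (_ + _).
apply: eq_big_nat => m /andP[_]; rewrite ltnS => mn.
have -> : q ^+ n.+1 = q ^+ m * q ^+ (n - m).+1 by rewrite -exprD addnS subnKC.
by rewrite subSn // -(qpoch_invS (n - m)); ring.
Qed.

Lemma qtrans_scale2 f n : q ^+ (2 * n) * qtrans f n =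
  seq_diff (qtrans (seq_scale (seq_diff (seq_scale f)))) n.
Proof.
by rewrite mulSn mul1n exprD -mulrA qtrans_scale -qtrans_diff qtrans_scale.
Qed.

Lemma qtrans_scale3 f n : q ^+ (3 * n) * qtrans f n =
  seq_diff (qtrans
    (seq_scale (seq_diff (seq_scale (seq_diff (seq_scale f)))))) n.
Proof.
by rewrite mulSn exprD -mulrA qtrans_scale2 -qtrans_diff qtrans_scale.
Qed.

(* [qtrans Pabc] will be the right-hand side for the profile [(a, b, c)]. *)
Definition P211 m := moment q m 0 / qpoch q q m.
Definition P310 m := moment q m 1 / qpoch q q m.
Definition P400 m := q ^+ m * P310 m.
(** The shifted term is the second sum of the formula, reindexed by n1 = l + 1; the power q^(2l+1)
    comes from [quadfS0]. *)
Definition P301 m :=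
  q ^+ m * P211 m + seq_shift (fun l => q ^+ (2 * l + 1) * P310 l) m.
Definition P220 m := q ^+ m * P211 m
  + seq_shift (fun l => q ^+ (2 * l + 1) * P211 l
                        + q ^+ (3 * l + 2) * P310 l) m.

Lemma P211_0 : P211 0 = 1.
Proof.
by rewrite /P211 /moment big_nat1 /quadf /= expr0 mulr1 qpoch0 divr1.
Qed.

Lemma P310_0 : P310 0 = 1.
Proof.
by rewrite /P310 /moment big_nat1 /quadf /= expr0 mulr1 qpoch0 divr1.
Qed.

(** This is [moment0_S] divided by (q;q)_m. *)
Lemma P211_S m : let y := q ^+ m in (1 - q * y) * P211 m.+1 =
  q * y ^+ 2 * (1 + q * y) * P211 m + q * y * (1 + q ^+ 2 * y ^+ 3) * P310 m.
Proof.
move=> y; rewrite /P211 /P310 moment0_S -/y.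
by rewrite -(qpoch_invS m) [q ^+ m.+1]exprS -/y; ring.
Qed.

Lemma P310_S m : let y := q ^+ m in P310 m.+1 =
  (q * y) ^+ 2 * P211 m.+1
  + q * y ^+ 2 * (1 + q * y) * (P211 m + q * y * P310 m).
Proof.
move=> y; rewrite /P211 /P310 moment1_S -/y.
by rewrite -(qpoch_invS m) [q ^+ m.+1]exprS -/y; ring.
Qed.

(** The [_rec] lemmas are the equations of [cyl_system] before the transform, with a common outer
    [seq_diff] removed: q^n becomes [seq_scale], and each further power of q^n adds a [seq_diff] and
    a [seq_scale]. Here the content is [P310_S]. *)
Lemma P310_rec m : P310 m = seq_scale P220 m + seq_scale P301 m
  - seq_scale (seq_diff (seq_scale P211)) m.
Proof.
rewrite /seq_scale /seq_diff /P220 /P301; case: m => [|m] /=.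
  by rewrite P310_0 P211_0 !expr0; ring.
rewrite P310_S !(mulnC _ m) ![q ^+ (m * _ + _)]exprD !exprM [q ^+ m.+1]exprS.
by move: (q ^+ m) (P211 m) (P310 m) (P211 m.+1) => y a b c; ring.
Qed.

(** This one and [P220_rec] follow formally from the definitions and the values at 0. *)
Lemma P301_rec m : P301 m = seq_scale P211 m + seq_scale P400 m
  - seq_scale (seq_diff (seq_scale P310)) m.
Proof.
rewrite /seq_scale /seq_diff /P400 /P301; case: m => [|m] /=.
  by rewrite P310_0 P211_0 !expr0; ring.
rewrite !(mulnC _ m) ![q ^+ (m * _ + _)]exprD !exprM [q ^+ m.+1]exprS.
by move: (q ^+ m) (P211 m) (P310 m) (P211 m.+1) => y a b c; ring.
Qed.

Lemma P220_rec m : P220 m = seq_scale P301 m + seq_scale P211 m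
  - seq_scale (seq_diff (seq_scale P211)) m.
Proof.
rewrite /seq_scale /seq_diff /P220 /P301; case: m => [|m] /=.
  by rewrite P211_0 !expr0; ring.
rewrite !(mulnC _ m) ![q ^+ (m * _ + _)]exprD !exprM [q ^+ m.+1]exprS.
by move: (q ^+ m) (P211 m) (P310 m) (P211 m.+1) => y a b c; ring.
Qed.

Lemma P211_rec m : P211 m =
  seq_scale P211 m + seq_scale P220 m + seq_scale P310 m
  - seq_scale (seq_diff (seq_scale P211)) m
  - seq_scale (seq_diff (seq_scale P220)) m
  - seq_scale (seq_diff (seq_scale P301)) m
  + seq_scale (seq_diff (seq_scale (seq_diff (seq_scale P211)))) m.
Proof.
(* The terms reach back two indices, so 0 and 1 are treated apart. *)
rewrite /seq_scale /seq_diff /P220 /P301; case: m => [|[|m]] /=.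
- by rewrite P310_0 P211_0 !expr0; ring.
- have := P211_S 0; have := P310_S 0.
  rewrite /= P211_0 P310_0 !expr0 !expr1 => e2 e1.
  by apply: (eq_comb2 1 (- q) e1 e2); ring.
- have := P211_S m.+1; have := P310_S m.+1; have := P310_S m.
  rewrite /= !(mulnC _ m.+1) !(mulnC _ m) ![q ^+ (_ * _ + _)]exprD !exprM.
  rewrite [q ^+ m.+2]exprS [q ^+ m.+1]exprS.
  move: (q ^+ m) (P211 m) (P310 m) (P211 m.+1) (P310 m.+1) (P211 m.+2)
    (P310 m.+2).
  move=> y a b a1 b1 a2 b2 e3 e2 e1.
  (* The combination is [P211_S] at m + 1 minus q^(m+2) times the difference of [P310_S] at m + 1
     and at m. *)
  apply: (eq_comb3 1 (- (q * (q * y))) (q * (q * y)) e1 e2 e3).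
  by ring.
Qed.

Let qtransE f n : qtrans f n.+1 = qtrans f n + qtrans (seq_diff f) n.+1.
Proof. by rewrite qtrans_diff /seq_diff /= addrC subrK. Qed.

Lemma eq_seq_diff (f g : nat -> R) :
  f =1 g -> seq_diff f =1 seq_diff g.
Proof. by move=> fg; case=> [|m]; rewrite /seq_diff /= !fg. Qed.

Lemma qtrans_system :
  cyl_system q (qtrans P400) (qtrans P310) (qtrans P301)
    (qtrans P220) (qtrans P211).
Proof.
split=> [|n|n|n|n|n].
- rewrite !qtrans0 /P400 /P301 /P220 /= !P310_0 !P211_0.
  by rewrite !expr0 mulr1 addr0.
(* [P400] is [seq_scale P310] by definition. *)
- by rewrite qtrans_scale // -qtrans_diff -qtransE.
(* Here and below, all terms are gathered under a single [qtrans], and the equation becomes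
   [seq_diff] of a [_rec] lemma. *)
- rewrite [LHS]qtransE mulrDr !(qtrans_scale, qtrans_scale2) // -!qtrans_diff.
  rewrite -addrA; congr (_ + _); rewrite -qtransD -qtransB.
  apply: eq_qtrans => m; rewrite (eq_seq_diff P310_rec) /seq_diff.
  by case: m => [|m] /=; ring.
- rewrite [LHS]qtransE mulrDr !(qtrans_scale, qtrans_scale2) // -!qtrans_diff.
  rewrite -addrA; congr (_ + _); rewrite -qtransD -qtransB.
  apply: eq_qtrans => m; rewrite (eq_seq_diff P301_rec) /seq_diff.
  by case: m => [|m] /=; ring.
- rewrite [LHS]qtransE mulrDr !(qtrans_scale, qtrans_scale2) // -!qtrans_diff.
  rewrite -addrA; congr (_ + _); rewrite -qtransD -qtransB.
  apply: eq_qtrans => m; rewrite (eq_seq_diff P220_rec) /seq_diff.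
  by case: m => [|m] /=; ring.
- rewrite [LHS]qtransE !mulrDr !opprD.
  rewrite !(qtrans_scale, qtrans_scale2, qtrans_scale3) //.
  rewrite -!qtrans_diff -!addrA; congr (_ + _).
  rewrite !addrA -!qtransD -!qtransB -qtransD.
  apply: eq_qtrans => m; rewrite (eq_seq_diff P211_rec) /seq_diff.
  by case: m => [|m] /=; ring.
Qed.

(** * Expansion of the transforms into double sums *)

Lemma qtrans_moment (a : nat -> R) j n :
  qtrans (fun m => a m * (moment q m j / qpoch q q m)) n =
  \sum_(0 <= m < n.+1) \sum_(0 <= k < (2 * m).+1)
    a m * q ^+ (quadf m k + j * k)
      / (qpoch q q (n - m) * qpoch q q m) * qbinom q (2 * m) k.
Proof.
apply: eq_bigr => m _; rewrite /moment mulr_suml mulr_sumr mulr_suml.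
apply: eq_big_nat => k; rewrite ltnS => /andP[_ km].
by rewrite qbinomE // invrM ?qpoch_unit //; ring.
Qed.

Lemma qtrans_P400 n : qtrans P400 n =
  \sum_(0 <= n1 < n.+1) \sum_(0 <= n2 < (2 * n1).+1)
    q ^+ (n1 ^ 2 + n2 ^ 2 - n1 * n2 + n1 + n2)
      / (qpoch q q (n - n1) * qpoch q q n1) * qbinom q (2 * n1) n2.
Proof.
rewrite qtrans_moment; apply: eq_bigr => m _; apply: eq_bigr => k _.
by rewrite -exprD mul1n addnA [(m + _)%N]addnC.
Qed.

Lemma qtrans_P310 n : qtrans P310 n =
  \sum_(0 <= n1 < n.+1) \sum_(0 <= n2 < (2 * n1).+1)
    q ^+ (n1 ^ 2 + n2 ^ 2 - n1 * n2 + n2)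
      / (qpoch q q (n - n1) * qpoch q q n1) * qbinom q (2 * n1) n2.
Proof.
transitivity (qtrans (fun m => 1 * P310 m) n).
  by apply: eq_qtrans => m; rewrite mul1r.
rewrite qtrans_moment; apply: eq_bigr => m _; apply: eq_bigr => k _.
by rewrite mul1r mul1n.
Qed.

Lemma qtrans_P211 n : qtrans P211 n =
  \sum_(0 <= n1 < n.+1) \sum_(0 <= n2 < (2 * n1).+1)
    q ^+ (n1 ^ 2 + n2 ^ 2 - n1 * n2)
      / (qpoch q q (n - n1) * qpoch q q n1) * qbinom q (2 * n1) n2.
Proof.
transitivity (qtrans (fun m => 1 * P211 m) n).
  by apply: eq_qtrans => m; rewrite mul1r.
rewrite qtrans_moment; apply: eq_bigr => m _; apply: eq_bigr => k _.
by rewrite mul1r addn0.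
Qed.

Let qtrans_scaled_P211 n : qtrans (fun m => q ^+ m * P211 m) n =
  \sum_(0 <= n1 < n.+1) \sum_(0 <= n2 < (2 * n1).+1)
    q ^+ (n1 ^ 2 + n2 ^ 2 - n1 * n2) / qpoch q q (n - n1)
      * (q ^+ n1 / qpoch q q n1) * qbinom q (2 * n1) n2.
Proof.
rewrite qtrans_moment; apply: eq_bigr => m _; apply: eq_bigr => k _.
by rewrite addn0 invrM ?qpoch_unit // /quadf; ring.
Qed.

Let quadf_step m k :
  q ^+ (m.+1 ^ 2 + k ^ 2 - m.+1 * k) * q ^+ k =
  q ^+ (2 * m + 1) * q ^+ quadf m k.
Proof.
rewrite -!exprD; congr (q ^+ _).
by have := quadfS0 m k; rewrite /quadf; lia.
Qed.

Lemma qtrans_P301 n : qtrans P301 n =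
  \sum_(0 <= n1 < n.+1) \sum_(0 <= n2 < (2 * n1).+1)
    q ^+ (n1 ^ 2 + n2 ^ 2 - n1 * n2) / qpoch q q (n - n1)
      * (q ^+ n1 / qpoch q q n1) * qbinom q (2 * n1) n2
  + \sum_(1 <= n1 < n.+1) \sum_(0 <= n2 < (2 * n1 - 2).+1)
    q ^+ (n1 ^ 2 + n2 ^ 2 - n1 * n2) / qpoch q q (n - n1)
      * (q ^+ (2 * n2) / qpoch q q (n1 - 1)) * qbinom q (2 * n1 - 2) n2.
Proof.
rewrite qtransD qtrans_scaled_P211 qtrans_shift; congr (_ + _).
(* Reindexing by n1 = m + 1; for n = 0 the second sum is empty and [seq_shift] has its default value
   0. *)
rewrite big_add1 /=; case: n => [|n]; first by rewrite big_geq.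
rewrite /seq_shift qtrans_moment; apply: eq_bigr => m _.
rewrite subSS subn1 /= (_ : 2 * m.+1 - 2 = 2 * m)%N;
  last by rewrite mulnS addKn.
apply: eq_bigr => k _.
rewrite mul1n [q ^+ (_ + k)]exprD mulrA -quadf_step.
rewrite [(2 * k)%N]mulSn mul1n [q ^+ (k + k)]exprD invrM ?qpoch_unit //.
by ring.
Qed.

Lemma qtrans_P220 n : qtrans P220 n =
  \sum_(0 <= n1 < n.+1) \sum_(0 <= n2 < (2 * n1).+1)
    q ^+ (n1 ^ 2 + n2 ^ 2 - n1 * n2) / qpoch q q (n - n1)
      * (q ^+ n1 / qpoch q q n1) * qbinom q (2 * n1) n2
  + \sum_(1 <= n1 < n.+1) \sum_(0 <= n2 < (2 * n1 - 2).+1)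
    q ^+ (n1 ^ 2 + n2 ^ 2 - n1 * n2) / qpoch q q (n - n1)
      * (q ^+ n2 * (1 + q ^+ (n1 + n2)) / qpoch q q (n1 - 1))
      * qbinom q (2 * n1 - 2) n2.
Proof.
rewrite qtransD qtrans_scaled_P211 qtrans_shift; congr (_ + _).
rewrite big_add1 /=; case: n => [|n]; first by rewrite big_geq.
rewrite /seq_shift qtransD !qtrans_moment -big_split; apply: eq_bigr => m _ /=.
rewrite subSS subn1 /= (_ : 2 * m.+1 - 2 = 2 * m)%N;
  last by rewrite mulnS addKn.
rewrite -big_split; apply: eq_bigr => k _ /=.
(* Both summands then share q^(2m+1), and what remains is the factor 1 + q^(n1+n2). *)
have -> : q ^+ (3 * m + 2) = q ^+ (2 * m + 1) * q ^+ m.+1.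
  by rewrite -exprD; congr (q ^+ _); lia.
rewrite addn0 mul1n [q ^+ (quadf m k + k)]exprD [q ^+ (m.+1 + k)]exprD.
rewrite [_ * q ^+ m.+1 * _]mulrAC !mulrA -quadf_step invrM ?qpoch_unit //.
by ring.
Qed.

End QTransform.
(** * Cylindric partitions *)

Section FpsXn.
Variable R : comNzRingType.
Implicit Type f : fps R.

Lemma coef_fpsXM f m : (fpsX R * f) m = if m is m'.+1 then f m' else 0.
Proof.
rewrite coef_fpsM; case: m => [|m].
  by rewrite big_ord1 coef_fpsX mul0r.
rewrite 2!big_ord_recl !coef_fpsX mul0r add0r mul1r subSS subn0 big1 ?addr0 //.
by move=> i _; rewrite coef_fpsX mul0r.
Qed.

Lemma coef_fpsXnM f e m :
  (fpsX R ^+ e * f) m = if (e <= m)%N then f (m - e)%N else 0.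
Proof.
elim: e m => [|e IHe] m; first by rewrite mul1r subn0.
by rewrite exprS -mulrA coef_fpsXM; case: m => // m; rewrite IHe subSS.
Qed.

End FpsXn.

Section Cylindric.
Local Open Scope classical_set_scope.

Lemma card_fset_set_bij (T : choiceType) (A B : set T) (f g : T -> T) :
  finite_set A -> {homo f : x / A x >-> B x} -> {homo g : x / B x >-> A x} ->
  (forall x, A x -> g (f x) = x) -> (forall x, B x -> f (g x) = x) ->
  #|` fset_set A| = #|` fset_set B|.
Proof.
move=> finA fAB gBA gf fg.
have -> : B = f @` A.
  apply/seteqP; split=> [y By|_ [x Ax <-]]; last exact: fAB.
  by exists (g y); [exact: gBA|exact: fg].
rewrite fset_set_image // card_in_imfset //= => x y.
rewrite !in_fset_set // !inE => Ax Ay fxy.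
by rewrite -(gf x Ax) -(gf y Ay) fxy.
Qed.

(** Any large enough cutoff works, so two partitions can be summed up to a common one. *)
Lemma partition_sum (lam : nat -> nat) : is_partition lam ->
  exists N, forall M, (N <= M)%N ->
  \big[addn/0%N]_(j \in [set: nat]) lam j = (\sum_(j < M) lam j)%N.
Proof.
move=> [dec fin].
have [N hN] : exists N, forall j, (N <= j)%N -> lam j = 0%N.
  exists (\max_(j <- fset_set [set j | lam j <> 0%N]) j.+1)%N => j Nj.
  apply: contrapT => lj.
  have : (j < \max_(j <- fset_set [set j | lam j <> 0%N]) j.+1)%N.
    apply: (@leq_bigmax_seq _ _ _ (fun j => j.+1)) => //.
    by rewrite in_fset_set // inE.
  by rewrite ltnNge Nj.
exists N => M NM; rewrite fsbig_ord; apply: esym; apply: fsbig_widen => //.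
move=> j [_ /= /negP]; rewrite -leqNgt => Mj.
by rewrite /= hN // (leq_trans NM).
Qed.

Lemma partition_sumS (lam : nat -> nat) : is_partition lam ->
  is_partition (fun j => lam j.+1) ->
  \big[addn/0%N]_(j \in [set: nat]) lam j =
  (lam 0 + \big[addn/0]_(j \in [set: nat]) lam j.+1)%N.
Proof.
move=> /partition_sum[N hN] /partition_sum[N' hN'].
rewrite (hN (maxn N N').+1); last by rewrite leqW // leq_maxl.
by rewrite (hN' (maxn N N')) ?leq_maxr // big_ord_recl.
Qed.

Lemma is_partition_behead (lam : nat -> nat) :
  is_partition lam -> is_partition (fun j => lam j.+1).
Proof.
move=> [dec fin]; split=> [i j ij|]; first exact: dec.
apply: sub_finite_set fin => j /= lj lj0; apply: lj.
by apply/eqP; rewrite -leqn0 -lj0 dec.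
Qed.

Lemma is_partition_cons (lam : nat -> nat) (n : nat) :
  is_partition lam -> (lam 0 <= n)%N ->
  is_partition (fun j => if j is j'.+1 then lam j' else n).
Proof.
move=> [dec fin] ln; split=> [[|i] [|j] ij //|]; last first.
  apply: (@sub_finite_set _ _ ([set 0%N] `|` S @` [set j | lam j <> 0%N])).
    by move=> [|j] lj; [left|right; exists j].
  by rewrite finite_setU; split; [exact: finite_set1|exact: finite_image].
  exact: dec.
by apply: leq_trans ln; exact: dec.
Qed.

(** * Inclusion-exclusion over the rows that reach the maximum *)

Section Profile.
Variables (k : nat) (c : k.-tuple nat).
Implicit Types (L : 'I_k -> nat -> nat) (J s : seq 'I_k).

(** The intermediate families of the inclusion-exclusion: [J] holds the rows forced to reach the
    bound, [s] those forbidden to. *)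
Definition cyl_pat n J s m : set ('I_k -> nat -> nat) :=
  [set L | [/\ cyl_set c n m L, forall i, i \in J -> L i 0%N = n
             & forall i, i \in s -> L i 0%N <> n]].

Lemma finite_cyl_pat n J s m : finite_set (cyl_pat n J s m).
Proof. by apply: sub_finite_set (finite_cyl_set c n m) => L []. Qed.

Definition cylF_pat n J s : fps int :=
  Fps (fun m => (#|` fset_set (cyl_pat n J s m)|)%:R).

Lemma cylF_pat_nil n : cylF_pat n [::] [::] = cylF c n.
Proof.
apply/fpsP => m /=; congr (#|` fset_set _|%:R).
by apply/seteqP; split=> [L []|L LP]; [|split].
Qed.

(** One step of inclusion-exclusion: forbidding row [i] is leaving it free minus forcing it.
    Iteration empties [s] and yields the signed sum over subsets. *)
Lemma cylF_pat_cons n J i s :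
  cylF_pat n J (i :: s) = cylF_pat n J s - cylF_pat n (i :: J) s.
Proof.
apply/fpsP => m; rewrite coef_fpsD coef_fpsN /=.
have fin := finite_cyl_pat n J s m.
have -> : cyl_pat n J (i :: s) m = cyl_pat n J s m `\` cyl_pat n (i :: J) s m.
  apply/seteqP; split=> [L [LP LJ Ls]|L [[LP LJ Ls] nL]].
    split; first by split=> // l ls; apply: Ls; rewrite inE ls orbT.
    by move=> [_ LJ' _]; apply: (Ls i); rewrite ?LJ' ?inE ?eqxx.
  split=> // l; rewrite inE => /predU1P[->|]; last exact: Ls.
  by move=> Li; apply: nL; split=> // l'; rewrite inE => /predU1P[->|/LJ].
have sub : cyl_pat n (i :: J) s m `<=` cyl_pat n J s m.
  by move=> L [LP LJ Ls]; split=> // l lJ; apply: LJ; rewrite inE lJ orbT.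
rewrite fset_setD //; last exact: finite_cyl_pat.
rewrite -(cardfsID (fset_set (cyl_pat n (i :: J) s m))
                   (fset_set (cyl_pat n J s m))).
rewrite -fset_setI //; last exact: finite_cyl_pat.
by rewrite (setIidr sub) natrD addrAC subrr add0r.
Qed.

Lemma cyl_max_geP n L : (cyl_max L <= n)%N <-> forall i, (L i 0 <= n)%N.
Proof. by split=> [/bigmax_leqP h i|h]; [exact: h|apply/bigmax_leqP]. Qed.

(** Induction around the cycle: k - i0 + i successor steps lead from [i0] to [i]. *)
Lemma ordS_orbit (P : 'I_k -> Prop) (i0 : 'I_k) :
  P i0 -> (forall i, P i -> P (ordS i)) -> forall i, P i.
Proof.
move=> P0 PS i.
have iterP t : P (iter t (@ordS k) i0) by elim: t => //= t; exact: PS.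
have itE t : iter t (@ordS k) i0 = ((i0 + t) %% k)%N :> nat.
  elim: t => [|t IHt] /=; first by rewrite addn0 modn_small.
  by rewrite IHt -addn1 modnDml addn1 addnS.
suff -> : i = iter (k - i0 + i) (@ordS k) i0 by exact: iterP.
apply: val_inj; rewrite /= itE addnA subnKC; last exact: ltnW.
by rewrite modnDl modn_small.
Qed.

(* Where the profile vanishes the first part is bounded by the previous one,
   so the maximum is attained at some [i] with [tnth c i != 0]. *)
Lemma cylF_pat_lower n s i0 :
  (forall i, i \in s = (0 < tnth c i)%N) -> i0 \in s ->
  cylF_pat n.+1 [::] s = cylF c n.
Proof.
move=> sP si0; apply/fpsP => m /=; congr (#|` fset_set _|%:R).
apply/seteqP; split=> L.
  case=> -[cylL /cyl_max_geP maxL sizeL] _ Ls; split=> //.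
  have Llt i : i \in s -> (L i 0 <= n)%N.
    by move=> /Ls/eqP Li; rewrite -ltnS ltn_neqAle Li maxL.
  apply/cyl_max_geP; apply: (@ordS_orbit _ i0); first exact: Llt.
  move=> i Lin; have [cS|] := boolP (ordS i \in s); first exact: Llt.
  rewrite sP -eqn0Ngt => /eqP c0; apply: leq_trans Lin.
  by have [_ /(_ i 0%N)] := cylL; rewrite c0 addn0.
case=> cylL /cyl_max_geP maxL sizeL; split=> //.
  by split=> //; apply/cyl_max_geP => i; rewrite leqW.
by move=> i _ Li; have := maxL i; rewrite Li ltnn.
Qed.

Lemma cylF0 : cylF c 0 = 1.
Proof.
have szero : cyl_size (fun (_ : 'I_k) (_ : nat) => 0%N) = 0%N.
  by rewrite /cyl_size big1 // => i _; rewrite fsbig1.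
apply/fpsP => m; rewrite coef_fps1 /=.
have zeroE L : cyl_set c 0 m L -> L = fun _ _ => 0%N.
  case=> -[part _] /cyl_max_geP maxL _; apply/funext => i; apply/funext => j.
  have [dec _] := part i.
  by apply/eqP; rewrite -leqn0 (leq_trans (dec _ _ (leq0n j))).
case: (eqVneq m 0%N) => [m0|m0] /=.
  have -> : cyl_set c 0 m = [set fun _ _ => 0%N].
    apply/seteqP; split=> [L /zeroE //|L ->]; split; last by rewrite szero.
      split=> // i; split=> //=; rewrite (_ : [set _ | _] = set0) //.
      by apply/seteqP; split.
    by apply/cyl_max_geP.
  by rewrite fset_set1 cardfs1.
have -> : cyl_set c 0 m = set0.
  apply/seteqP; split=> // L LP; have := LP; rewrite (zeroE L LP).
  by case=> _ _; rewrite szero => m0'; rewrite -m0' eqxx in m0.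
by rewrite fset_set0 cardfs0.
Qed.

End Profile.

(** Membership is coerced to 0 or 1, so one formula drops the first part of the rows in [J] and
    keeps the other rows. *)
Definition cut_rows k (J : seq 'I_k) (L : 'I_k -> nat -> nat) i j :=
  L i (j + (i \in J))%N.

Definition fill_rows k (J : seq 'I_k) n (L : 'I_k -> nat -> nat) i j :=
  if i \in J then (if j is j'.+1 then L i j' else n) else L i j.

Lemma cut_rowsK k (J : seq 'I_k) n L :
  (forall i, i \in J -> L i 0%N = n) -> fill_rows J n (cut_rows J L) = L.
Proof.
move=> LJ; apply/funext => i; apply/funext => j; rewrite /fill_rows /cut_rows.
case: (boolP (i \in J)) => [/LJ <-|_]; rewrite ?addn0 //.
by case: j => [|j]; rewrite ?addn1.
Qed.

Lemma fill_rowsK k (J : seq 'I_k) n L : cut_rows J (fill_rows J n L) = L.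
Proof.
apply/funext => i; apply/funext => j; rewrite /fill_rows /cut_rows.
by case: (i \in J); rewrite ?addn1 ?addn0.
Qed.

Lemma cyl_size_cut k (J : seq 'I_k) n L : uniq J ->
  (forall i, is_partition (L i)) -> (forall i, i \in J -> L i 0%N = n) ->
  cyl_size L = (n * size J + cyl_size (cut_rows J L))%N.
Proof.
move=> uJ part LJ; rewrite /cyl_size.
have -> : (n * size J = \sum_(i < k) n * (i \in J))%N.
  by rewrite -big_distrr /= -big_mkcond sum1_card (card_uniqP uJ).
rewrite -big_split; apply: eq_bigr => i _ /=; rewrite /cut_rows.
case: (boolP (i \in J)) => [iJ|_].
  rewrite partition_sumS //; last exact: is_partition_behead.
  rewrite LJ // muln1; congr (_ + _)%N.
  by apply: eq_fsbigr => j _; rewrite addn1.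
by rewrite muln0 add0n; apply: eq_fsbigr => j _; rewrite addn0.
Qed.

Section CutProfile.
Variables (k : nat) (c c' : k.-tuple nat) (n : nat) (J : seq 'I_k).
Hypothesis uJ : uniq J.
(** This makes [c'] the profile c(J): cutting row i raises the offset between rows i and i + 1,
    cutting row i + 1 lowers it. The additive form avoids truncated subtraction. *)
Hypothesis cc' : forall i,
  (tnth c (ordS i) + (i \in J) = tnth c' (ordS i) + (ordS i \in J))%N.

Lemma cyl_pat_cut m L : cyl_pat c n J [::] m L ->
  exists2 m', m = (n * size J + m')%N & cyl_set c' n m' (cut_rows J L).
Proof.
case=> -[[part cyl] /cyl_max_geP maxL sizeL] LJ _.
exists (cyl_size (cut_rows J L)); first by rewrite -sizeL; apply: cyl_size_cut.
split=> //.
  split=> [i|i j]; rewrite /cut_rows.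
    case: (i \in J); last by under eq_fun do rewrite addn0.
    by under eq_fun do rewrite addn1; apply: is_partition_behead.
  by rewrite -addnA -cc' [(tnth _ _ + _)%N]addnC addnA; apply: cyl.
apply/cyl_max_geP => i; have [dec _] := part i.
by apply: leq_trans (maxL i); apply: dec.
Qed.

Lemma cyl_set_fill m L : cyl_set c' n m L ->
  cyl_pat c n J [::] (n * size J + m) (fill_rows J n L).
Proof.
case=> -[part cyl] /cyl_max_geP maxL sizeL.
have le_n i j : (L i j <= n)%N.
  by have [dec _] := part i; apply: leq_trans (maxL i); apply: dec.
have partF i : is_partition (fill_rows J n L i).
  rewrite /fill_rows; case: (i \in J) => //.
  exact: is_partition_cons.
have fill_le i j : (fill_rows J n L i j <= n)%N.
  by rewrite /fill_rows; case: (i \in J) => //; case: j.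
have fillJ i : i \in J -> fill_rows J n L i 0%N = n by rewrite /fill_rows => ->.
split=> //; split.
- split=> // i j.
  have shift l j' : L l j' = fill_rows J n L l (j' + (l \in J))%N.
    by rewrite -[in LHS](fill_rowsK J n L).
  (* Otherwise j = 0 and row i is filled, so the right side is n, which bounds every entry. *)
  have [jJ|] := leqP (i \in J) j.
    rewrite -(subnK jJ) -addnA [((i \in J) + _)%N]addnC cc' addnA -!shift.
    exact: cyl.
  by case: (boolP (i \in J)) => // iJ; case: j => // _; rewrite fillJ.
- exact/cyl_max_geP.
- by rewrite (@cyl_size_cut _ J n) // fill_rowsK sizeL.
Qed.

(** Cutting and filling are inverse bijections, and cutting removes [size J] parts equal to n. *)
Lemma cylF_pat_cut :
  cylF_pat c n J [::] = fpsX int ^+ (n * size J) * cylF c' n.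
Proof.
(* In degrees below n times [size J] no such cylindric partition exists. *)
apply/fpsP => m; rewrite coef_fpsXnM /=; case: leqP => em; last first.
  rewrite (_ : cyl_pat _ _ _ _ _ = set0) ?fset_set0 ?cardfs0 //.
  apply/seteqP; split=> // L /cyl_pat_cut[m' mE _].
  by move: em; rewrite mE ltnNge leq_addr.
congr (_%:R); apply: (@card_fset_set_bij _ _ _ (cut_rows J) (fill_rows J n)).
- exact: finite_cyl_pat.
- by move=> L /cyl_pat_cut[m' -> ?]; rewrite addKn.
- by move=> L /cyl_set_fill; rewrite subnKC.
- by move=> L [_ LJ _]; apply: cut_rowsK.
- by move=> L _; apply: fill_rowsK.
Qed.

End CutProfile.

Lemma cyl_size_rot k (L : 'I_k -> nat -> nat) :
  cyl_size (fun i => L (ordS i)) = cyl_size L.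
Proof. by rewrite /cyl_size [RHS](reindex_inj (@ordS_inj k)). Qed.

Lemma cyl_set_rot k (c c' : k.-tuple nat) n m L :
  (forall i, tnth c' i = tnth c (ordS i)) ->
  cyl_set c n m L -> cyl_set c' n m (fun i => L (ordS i)).
Proof.
move=> cc' [[part cyl] /cyl_max_geP maxL sizeL]; split.
- by split=> // i j; rewrite cc'.
- by apply/cyl_max_geP.
- by rewrite cyl_size_rot.
Qed.

Lemma cyl_set_rotV k (c c' : k.-tuple nat) n m L :
  (forall i, tnth c' i = tnth c (ordS i)) ->
  cyl_set c' n m L -> cyl_set c n m (fun i => L (ord_pred i)).
Proof.
move=> cc' [[part cyl] /cyl_max_geP maxL sizeL]; split.
- split=> // i j; rewrite ordSK -{2}(ord_predK i) -cc'.
  by have := cyl (ord_pred i) j; rewrite !ord_predK.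
- by apply/cyl_max_geP.
- rewrite -cyl_size_rot -sizeL; congr cyl_size.
  by apply/funext => i; rewrite ordSK.
Qed.

(** The defining inequalities are cyclically symmetric. This reduces every profile met below to the
    five chosen representatives. *)
Lemma cylF_rot k (c c' : k.-tuple nat) n :
  (forall i, tnth c' i = tnth c (ordS i)) -> cylF c n = cylF c' n.
Proof.
move=> cc'; apply/fpsP => m /=; congr (_%:R).
pose rotl (L : 'I_k -> nat -> nat) i := L (ordS i).
pose rotr (L : 'I_k -> nat -> nat) i := L (ord_pred i).
apply: (@card_fset_set_bij _ _ _ rotl rotr).
- exact: finite_cyl_set.
- by move=> L; apply: cyl_set_rot.
- by move=> L; apply: cyl_set_rotV.
- by move=> L _; apply/funext => i; rewrite /rotr /rotl ord_predK.
- by move=> L _; apply/funext => i; rewrite /rotr /rotl ordSK.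
Qed.

End Cylindric.

(** * The linear system *)

Section UniqueSolution.
Let q := fpsX int.

(** Divisibility of [f] by q^N. *)
Definition fps_low N (f : fps int) := forall m, (m < N)%N -> f m = 0.

Lemma fps_lowD N f g : fps_low N f -> fps_low N g -> fps_low N (f + g).
Proof. by move=> fN gN m mN; rewrite coef_fpsD fN ?gN ?addr0. Qed.

Lemma fps_lowN N f : fps_low N f -> fps_low N (- f).
Proof. by move=> fN m mN; rewrite coef_fpsN fN ?oppr0. Qed.

Lemma fps_lowM N f g : fps_low N g -> fps_low N (f * g).
Proof.
move=> gN m mN; rewrite coef_fpsM big1 // => i _.
by rewrite gN ?mulr0 // (leq_ltn_trans (leq_subr _ _)).
Qed.

Lemma fps_lowXn N n f : fps_low N f -> fps_low N.+1 (q ^+ n.+1 * f).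
Proof.
move=> fN m mN; rewrite coef_fpsXnM; case: leqP => // nm.
by apply: fN; lia.
Qed.

Lemma fps_low_eq0 f : (forall N, fps_low N f) -> f = 0.
Proof. by move=> f0; apply/fpsP => m; apply: (f0 m.+1). Qed.

(** Induction on n. At n + 1 the differences of two solutions satisfy a homogeneous system in which
    every term carries q^(n+1). They are therefore divisible by every power of q, hence 0. *)
Lemma cyl_system_unique f400 f310 f301 f220 f211 g400 g310 g301 g220 g211 :
  cyl_system q f400 f310 f301 f220 f211 ->
  cyl_system q g400 g310 g301 g220 g211 ->
  forall n, [/\ f400 n = g400 n, f310 n = g310 n, f301 n = g301 n,
                f220 n = g220 n & f211 n = g211 n].
Proof.
move=> [[f0 f1 f2 f3 f4] F0 F1 F2 F3 F4] [[g0 g1 g2 g3 g4] G0 G1 G2 G3 G4].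
elim=> [|n [e0 e1 e2 e3 e4]].
  by rewrite f0 f1 f2 f3 f4 g0 g1 g2 g3 g4.
move: {F0 F1 F2 F3 F4} (F0 n) (F1 n) (F2 n) (F3 n) (F4 n).
move: {G0 G1 G2 G3 G4} (G0 n) (G1 n) (G2 n) (G3 n) (G4 n).
rewrite {}e0 {}e1 {}e2 {}e3 {}e4 !(mulnC _ n.+1) !exprM.
move: (g400 n) (g310 n) (g301 n) (g220 n) (g211 n) => h0 h1 h2 h3 h4.
move: (g400 _) (g310 _) (g301 _) (g220 _) (g211 _) => {g0 g1 g2 g3 g4}
  g0 g1 g2 g3 g4 G0 G1 G2 G3 G4.
move: (f400 _) (f310 _) (f301 _) (f220 _) (f211 _) => {f0 f1 f2 f3 f4}
  f0 f1 f2 f3 f4 F0 F1 F2 F3 F4.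
set x := q ^+ n.+1 in G0 G1 G2 G3 G4 F0 F1 F2 F3 F4.
have D0 : f0 - g0 = x * (f1 - g1) by rewrite G0 F0; ring.
have D1 : f1 - g1 = x * ((f3 - g3) + (f2 - g2) - x * (f4 - g4)).
  by rewrite {1}G1 {1}F1; ring.
have D2 : f2 - g2 = x * ((f4 - g4) + (f0 - g0) - x * (f1 - g1)).
  by rewrite {1}G2 {1}F2; ring.
have D3 : f3 - g3 = x * ((f2 - g2) + (f4 - g4) - x * (f4 - g4)).
  by rewrite {1}G3 {1}F3; ring.
have D4 : f4 - g4 = x * ((f4 - g4) + (f3 - g3) + (f1 - g1)
    - x * ((f4 - g4) + (f3 - g3) + (f2 - g2)) + x ^+ 2 * (f4 - g4)).
  by rewrite {1}G4 {1}F4; ring.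
(* Each pass through the system gains at least one power of q. *)
have low N : [/\ fps_low N (f0 - g0), fps_low N (f1 - g1), fps_low N (f2 - g2),
                 fps_low N (f3 - g3) & fps_low N (f4 - g4)].
  elim: N => [//|N [l0 l1 l2 l3 l4]].
  split; [rewrite D0|rewrite D1|rewrite D2|rewrite D3|rewrite D4];
    apply: fps_lowXn => //;
    by repeat (first [exact | apply: fps_lowD | apply: fps_lowN
                     | apply: fps_lowM]).
have eq0 f g : (forall N, fps_low N (f - g)) -> f = g.
  by move=> /fps_low_eq0/eqP; rewrite subr_eq0 => /eqP.
by split; apply: eq0 => N; have [] := low N.
Qed.

End UniqueSolution.

(** * The recurrences for the five profiles *)

Section CylSystem.

Let o0 := @Ordinal 3 0 isT.
Let o1 := @Ordinal 3 1 isT.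
Let o2 := @Ordinal 3 2 isT.

Let cylF_pat3 c n J c' := @cylF_pat_cut 3 c c' n J.

Let cylF_rot3 a b c n : cylF [tuple a; b; c] n = cylF [tuple b; c; a] n.
Proof. by apply: cylF_rot; case=> -[|[|[|//]]]. Qed.

(** In each case the list given to [cylF_pat_lower] is the set I of positive entries, and each
    [cylF_pat3] names a subset J, in reverse order, together with the profile c(J). *)
Lemma cylF_system : cyl_system (fpsX int)
  (cylF [tuple 4; 0; 0]%N) (cylF [tuple 3; 1; 0]%N) (cylF [tuple 3; 0; 1]%N)
  (cylF [tuple 2; 2; 0]%N) (cylF [tuple 2; 1; 1]%N).
Proof.
split=> [|n|n|n|n|n]; first by rewrite !cylF0.
- rewrite -(@cylF_pat_lower _ _ n [:: o0] o0) //; last by case=> -[|[|[|//]]].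
  rewrite !cylF_pat_cons !cylF_pat_nil.
  rewrite (@cylF_pat3 _ _ [:: o0] [tuple 3; 1; 0]%N) //;
    last by case=> -[|[|[|//]]].
  by rewrite muln1; ring.
- rewrite -(@cylF_pat_lower _ _ n [:: o0; o1] o0) //;
    last by case=> -[|[|[|//]]].
  rewrite !cylF_pat_cons !cylF_pat_nil.
  rewrite (@cylF_pat3 _ _ [:: o0] [tuple 2; 2; 0]%N) //;
    last by case=> -[|[|[|//]]].
  rewrite (@cylF_pat3 _ _ [:: o1] [tuple 3; 0; 1]%N) //;
    last by case=> -[|[|[|//]]].
  rewrite (@cylF_pat3 _ _ [:: o1; o0] [tuple 2; 1; 1]%N) //;
    last by case=> -[|[|[|//]]].
  by rewrite muln1 [(_ * 2)%N]mulnC; ring.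
- rewrite -(@cylF_pat_lower _ _ n [:: o0; o2] o0) //;
    last by case=> -[|[|[|//]]].
  rewrite !cylF_pat_cons !cylF_pat_nil.
  rewrite (@cylF_pat3 _ _ [:: o0] [tuple 2; 1; 1]%N) //;
    last by case=> -[|[|[|//]]].
  rewrite (@cylF_pat3 _ _ [:: o2] [tuple 4; 0; 0]%N) //;
    last by case=> -[|[|[|//]]].
  rewrite (@cylF_pat3 _ _ [:: o2; o0] [tuple 3; 1; 0]%N) //;
    last by case=> -[|[|[|//]]].
  by rewrite muln1 [(_ * 2)%N]mulnC; ring.
- rewrite -(@cylF_pat_lower _ _ n [:: o0; o1] o0) //;
    last by case=> -[|[|[|//]]].
  rewrite !cylF_pat_cons !cylF_pat_nil.
  rewrite (@cylF_pat3 _ _ [:: o0] [tuple 1; 3; 0]%N) //;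
    last by case=> -[|[|[|//]]].
  rewrite (@cylF_pat3 _ _ [:: o1] [tuple 2; 1; 1]%N) //;
    last by case=> -[|[|[|//]]].
  rewrite (@cylF_pat3 _ _ [:: o1; o0] [tuple 1; 2; 1]%N) //;
    last by case=> -[|[|[|//]]].
  rewrite (cylF_rot3 1 3 0) (cylF_rot3 1 2 1).
  by rewrite muln1 [(_ * 2)%N]mulnC; ring.
- rewrite -(@cylF_pat_lower _ _ n [:: o0; o1; o2] o0) //;
    last by case=> -[|[|[|//]]].
  rewrite !cylF_pat_cons !cylF_pat_nil.
  rewrite (@cylF_pat3 _ _ [:: o0] [tuple 1; 2; 1]%N) //;
    last by case=> -[|[|[|//]]].
  rewrite (@cylF_pat3 _ _ [:: o1] [tuple 2; 0; 2]%N) //;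
    last by case=> -[|[|[|//]]].
  rewrite (@cylF_pat3 _ _ [:: o2] [tuple 3; 1; 0]%N) //;
    last by case=> -[|[|[|//]]].
  rewrite (@cylF_pat3 _ _ [:: o1; o0] [tuple 1; 1; 2]%N) //;
    last by case=> -[|[|[|//]]].
  rewrite (@cylF_pat3 _ _ [:: o2; o0] [tuple 2; 2; 0]%N) //;
    last by case=> -[|[|[|//]]].
  rewrite (@cylF_pat3 _ _ [:: o2; o1] [tuple 3; 0; 1]%N) //;
    last by case=> -[|[|[|//]]].
  rewrite (@cylF_pat3 _ _ [:: o2; o1; o0] [tuple 2; 1; 1]%N) //;
    last by case=> -[|[|[|//]]].
  (* The profiles (2,0,2) and (1,1,2) need two rotations each. *)
  rewrite (cylF_rot3 1 2 1) (cylF_rot3 2 0 2) (cylF_rot3 0 2 2).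
  rewrite (cylF_rot3 1 1 2) (cylF_rot3 1 2 1).
  by rewrite muln1 [(_ * 2)%N]mulnC [(_ * 3)%N]mulnC; ring.
Qed.

End CylSystem.

(** Every factor 1 - q^(i+1) has constant coefficient 1. *)
Lemma qpoch_fpsX_unit n : qpoch (fpsX int) (fpsX int) n \is a GRing.unit.
Proof.
rewrite /qpoch; elim/big_ind: _ => [|f g uf ug|i _]; first exact: unitr1.
  by rewrite unitrM uf.
rewrite fps_unitE coef_fpsD coef_fpsN coef_fps1.
by rewrite coef_fpsXM subr0 unitr1.
Qed.

Theorem theorem1p2 (n : nat) :
  let q : fps int := fpsX int in
  [/\ cylF [tuple 4; 0; 0]%N n =
        \sum_(0 <= n1 < n.+1) \sum_(0 <= n2 < (2 * n1).+1)
          q ^+ (n1 ^ 2 + n2 ^ 2 - n1 * n2 + n1 + n2)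
            / (qpoch q q (n - n1) * qpoch q q n1) * qbinom q (2 * n1) n2,
      cylF [tuple 3; 1; 0]%N n =
        \sum_(0 <= n1 < n.+1) \sum_(0 <= n2 < (2 * n1).+1)
          q ^+ (n1 ^ 2 + n2 ^ 2 - n1 * n2 + n2)
            / (qpoch q q (n - n1) * qpoch q q n1) * qbinom q (2 * n1) n2,
      cylF [tuple 3; 0; 1]%N n =
        \sum_(0 <= n1 < n.+1) \sum_(0 <= n2 < (2 * n1).+1)
          q ^+ (n1 ^ 2 + n2 ^ 2 - n1 * n2) / qpoch q q (n - n1)
            * (q ^+ n1 / qpoch q q n1) * qbinom q (2 * n1) n2
        + \sum_(1 <= n1 < n.+1) \sum_(0 <= n2 < (2 * n1 - 2).+1)
          q ^+ (n1 ^ 2 + n2 ^ 2 - n1 * n2) / qpoch q q (n - n1)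
            * (q ^+ (2 * n2) / qpoch q q (n1 - 1)) * qbinom q (2 * n1 - 2) n2,
      cylF [tuple 2; 2; 0]%N n =
        \sum_(0 <= n1 < n.+1) \sum_(0 <= n2 < (2 * n1).+1)
          q ^+ (n1 ^ 2 + n2 ^ 2 - n1 * n2) / qpoch q q (n - n1)
            * (q ^+ n1 / qpoch q q n1) * qbinom q (2 * n1) n2
        + \sum_(1 <= n1 < n.+1) \sum_(0 <= n2 < (2 * n1 - 2).+1)
          q ^+ (n1 ^ 2 + n2 ^ 2 - n1 * n2) / qpoch q q (n - n1)
            * (q ^+ n2 * (1 + q ^+ (n1 + n2)) / qpoch q q (n1 - 1))
            * qbinom q (2 * n1 - 2) n2
    & cylF [tuple 2; 1; 1]%N n =
        \sum_(0 <= n1 < n.+1) \sum_(0 <= n2 < (2 * n1).+1)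
          q ^+ (n1 ^ 2 + n2 ^ 2 - n1 * n2)
            / (qpoch q q (n - n1) * qpoch q q n1) * qbinom q (2 * n1) n2].
Proof.
move=> q; have qU := qpoch_fpsX_unit.
have [-> -> -> -> ->] := cyl_system_unique cylF_system (qtrans_system qU) n.
split.
- exact: qtrans_P400.
- exact: qtrans_P310.
- exact: qtrans_P301.
- exact: qtrans_P220.
- exact: qtrans_P211.
Qed.
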